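(* If $\Gamma\subseteq\mathbb{PT}^n$ is a fan tropical curve, then $\dim\operatorname{tconv}\Gamma\le\deg\Gamma$.
   Context: The tropical projective torus is $\mathbb{PT}^n=\mathbb{R}^{n+1}/\mathbb{R}\mathbf{1}$, where $\mathbf{1}=(1,\dots,1)$; it is identified with $\mathbb{R}^n$, for instance via representatives with first coordinate $0$. Tropical operations are $x\oplus y=\min(x,y)$ and $x\odot y=x+y$, with $c\odot u=(c+u_0,\dots,c+u_n)$ for $c\in\mathbb{R}$ and $u\in\mathbb{R}^{n+1}$, and $\oplus$ of vectors taken coordinatewise. For $U\subseteq\mathbb{R}^{n+1}$, the tropical convex hull $\operatorname{tconv}U$ is the set of all tropical linear combinations $c_1\odot u_1\oplus\cdots\oplus c_k\odot u_k$ with $k\ge1$, $u_i\in U$ and $c_i\in\mathbb{R}$. It is invariant under adding $\mathbb{R}\mathbf{1}$, so it defines a subset of $\mathbb{PT}^n$; for $U\subseteq\mathbb{PT}^n$ it is applied to the preimage of $U$ in $\mathbb{R}^{n+1}$. A tropical curve in $\mathbb{PT}^n$ is a one-dimensional rational polyhedral complex with positive integer weights (multiplicities) on its edges satisfying the balancing condition. It is a fan tropical curve if it consists of finitely many rays $\operatorname{pos}(v_1),\dots,\operatorname{pos}(v_k)$ emanating from the origin. For each unbounded ray $w_i+\operatorname{pos}(v_i)$ of a tropical curve, $v_i$ is chosen as the minimal nonnegative integer vector representative in $\mathbb{Z}^{n+1}$ generating it (nonnegative entries, at least one entry $0$, primitive). If $m_i$ is the multiplicity of that ray, the degree of $\Gamma$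 is the integer $\deg\Gamma$ with $(\deg\Gamma)\mathbf{1}=\sum_i m_iv_i$. Equivalently, $\deg\Gamma$ is the multiplicity of the stable intersection of $\Gamma$ with the standard tropical hyperplane. $\dim$ denotes the dimension as a polyhedral subset of $\mathbb{PT}^n\cong\mathbb{R}^n$. *)

(* Defs.v *)
From HB Require Import structures.
From mathcomp Require Import all_boot all_order all_algebra.
From mathcomp Require Import boolp classical_sets reals.
From mathcomp Require Import lra.

Set Implicit Arguments.
Unset Strict Implicit.
Unset Printing Implicit Defensive.

Import Order.TTheory GRing.Theory Num.Theory.

Local Open Scope classical_set_scope.
Local Open Scope ring_scope.

(* Points of PT^n = R^(n+1) / R1 are given by their coordinates in R^n, namely
   the last n coordinates of the representative whose first coordinate is 0. *)
Definition PTcoord (R : realType) (n : nat) (x : 'rV[R]_n.+1) : 'rV[R]_n :=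
  \row_(j < n) (x 0 (lift ord0 j) - x 0 ord0).

Lemma PTcoord_eq (R : realType) (n : nat) (x y : 'rV[R]_n.+1) :
  PTcoord x = PTcoord y <-> exists c : R, y = const_mx c + x.
Proof.
split=> [/rowP E|[c ->]]; last first.
  by apply/rowP=> j; rewrite !mxE; lra.
exists (y 0 ord0 - x 0 ord0); apply/rowP=> j; rewrite !mxE.
case: (unliftP ord0 j) => [k ->|->]; last by lra.
by have := E k; rewrite !mxE; lra.
Qed.

Definition tadd (R : realType) (m : nat) (x y : 'rV[R]_m) : 'rV[R]_m :=
  \row_j Num.min (x 0 j) (y 0 j).

Definition tscale (R : realType) (m : nat) (c : R) (x : 'rV[R]_m) : 'rV[R]_m :=
  \row_j (c + x 0 j).

(* Tropical addition has no neutral element over R, so the sum of the k.+1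
   terms is folded onto the term of index 0. *)
Definition tlincomb (R : realType) (m k : nat)
    (c : 'I_k.+1 -> R) (u : 'I_k.+1 -> 'rV[R]_m) : 'rV[R]_m :=
  \big[@tadd R m/tscale (c ord0) (u ord0)]_(i < k)
     tscale (c (lift ord0 i)) (u (lift ord0 i)).

Definition tconv (R : realType) (m : nat) (U : set 'rV[R]_m) : set 'rV[R]_m :=
  [set x | exists (k : nat) (c : 'I_k.+1 -> R) (u : 'I_k.+1 -> 'rV[R]_m),
             (forall i, U (u i)) /\ x = tlincomb c u].

Definition PTconv (R : realType) (n : nat) (U : set 'rV[R]_n) : set 'rV[R]_n :=
  @PTcoord R n @` tconv (@PTcoord R n @^-1` U).

Definition polyhedron (R : realType) (n : nat) (P : set 'rV[R]_n) : Prop :=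
  exists (m : nat) (A : 'M[R]_(n, m)) (b : 'rV[R]_m),
    P = [set x | forall j, (x *m A) 0 j <= b 0 j].

Definition affine_indep (R : realType) (n d : nat)
    (p : 'I_d.+1 -> 'rV[R]_n) : bool :=
  row_free (\matrix_(i < d) (p (lift ord0 i) - p ord0)).

(* Dimension of the affine hull of S (0 if S is empty). *)
Definition affdim (R : realType) (n : nat) (S : set 'rV[R]_n) : nat :=
  \max_(d < n.+1 | `[< exists p : 'I_d.+1 -> 'rV[R]_n,
                         (forall i, S (p i)) /\ affine_indep p >]) d.

(* Largest dimension of a polyhedron contained in S. For S a finite union of
   polyhedra this is the largest dimension of its cells: see polyhedral_dimE. *)
Definition polyhedral_dim (R : realType) (n : nat) (S : set 'rV[R]_n) : nat :=
  \max_(d < n.+1 | `[< exists P : set 'rV[R]_n,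
                         [/\ polyhedron P, P `<=` S & affdim P = d] >]) d.

Lemma affdim_le (R : realType) (n d : nat) (S : set 'rV[R]_n)
    (p : 'I_d.+1 -> 'rV[R]_n) :
  (forall i, S (p i)) -> affine_indep p -> (d <= affdim S)%N.
Proof.
move=> Sp ip; have dn : (d < n.+1)%N.
  by rewrite ltnS; move/eqP: (ip) => <-; exact: rank_leq_col.
apply: (@leq_bigmax_cond _ _ (fun i : 'I_n.+1 => nat_of_ord i) (Ordinal dn)).
by apply/asboolP; exists p.
Qed.

Lemma affdim_ub (R : realType) (n : nat) (S : set 'rV[R]_n) : (affdim S <= n)%N.
Proof. by apply/bigmax_leqP => i _; rewrite -ltnS. Qed.

Lemma polyhedron_moment (R : realType) (n d : nat) (P : set 'rV[R]_n)
    (p : 'I_d.+1 -> 'rV[R]_n) (t : R) :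
  polyhedron P -> (forall i, P (p i)) -> 0 <= t -> t * d%:R <= 1 ->
  t <= 1 ->
  P (p ord0 + \sum_(i < d) t ^+ i.+1 *: (p (lift ord0 i) - p ord0)).
Proof.
move=> [m [A [b ->]]] /= Pp t0 td t1 j.
rewrite mulmxDl mulmx_suml mxE summxE.
have -> : \sum_(i < d) (t ^+ i.+1 *: (p (lift ord0 i) - p ord0) *m A) 0 j =
   \sum_(i < d) t ^+ i.+1 * (p (lift ord0 i) *m A) 0 j
   - (\sum_(i < d) t ^+ i.+1) * (p ord0 *m A) 0 j.
  rewrite mulr_suml -sumrB; apply: eq_bigr => i _.
  by rewrite -scalemxAl mulmxBl !mxE mulrBr.
set s := \sum_(i < d) t ^+ i.+1.
have s1 : s <= 1.
  apply: le_trans td; rewrite mulr_natr -[X in t *+ X]card_ord -sumr_const.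
  apply: ler_sum => i _; rewrite exprS -[leRHS]mulr1 ler_wpM2l//.
  exact: exprn_ile1.
have h0 := Pp ord0 j.
have hs : \sum_(i < d) t ^+ i.+1 * (p (lift ord0 i) *m A) 0 j <= s * b 0 j.
  rewrite mulr_suml; apply: ler_sum => i _.
  by rewrite ler_wpM2l ?exprn_ge0//; exact: Pp.
have : 0 <= (1 - s) * (b 0 j - (p ord0 *m A) 0 j).
  by apply: mulr_ge0; rewrite subr_ge0.
set x := (p ord0 *m A) 0 j in h0 *; set y := b 0 j in h0 hs *.
by move: hs; set z := \sum_(i < d) _; lra.
Qed.

Lemma affine_indep_moment (R : realType) (n d : nat) (p : 'I_d.+1 -> 'rV[R]_n)
    (t : 'I_d.+1 -> R) :
  affine_indep p -> injective t ->
  affine_indep (fun k => p ord0 +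
    \sum_(i < d) t k ^+ i.+1 *: (p (lift ord0 i) - p ord0)).
Proof.
rewrite /affine_indep => ip it.
set M := (X in row_free X) in ip.
pose D : 'M[R]_d := \matrix_(k < d, i < d)
   (t (lift ord0 k) ^+ i.+1 - t ord0 ^+ i.+1).
have -> : \matrix_(i < d) (p ord0 + \sum_(i0 < d) t (lift ord0 i) ^+ i0.+1 *:
     (p (lift ord0 i0) - p ord0) -
     (p ord0 + \sum_(i0 < d) t ord0 ^+ i0.+1 *: (p (lift ord0 i0) - p ord0)))
   = D *m M.
  apply/row_matrixP => k; rewrite rowK row_mul mulmx_sum_row.
  rewrite opprD addrACA subrr add0r -sumrB; apply: eq_bigr => i _.
  by rewrite /M rowK !mxE scalerBl.
have Du : D^T \in unitmx.
  rewrite -row_free_unit; apply: inj_row_free => v /rowP vD.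
  pose c := \sum_(i < d) v 0 i * t ord0 ^+ i.+1.
  pose q : {poly R} := \poly_(k < d.+1)
    (if unlift ord0 (inord k : 'I_d.+1) is Some i then v 0 i else - c).
  have qE x : q.[x] = \sum_(i < d) v 0 i * x ^+ i.+1 - c.
    rewrite horner_poly big_ord_recl inord_val unlift_none expr0 mulr1 addrC.
    by congr (_ - _); apply: eq_bigr => i _; rewrite inord_val liftK.
  have rq k : root q (t k).
    rewrite /root qE; case: (unliftP ord0 k) => [l ->|->]; last by rewrite subrr.
    have := vD l; rewrite !mxE => H; apply/eqP; rewrite -[RHS]H -sumrB.
    by apply: eq_bigr => i _; rewrite !mxE mulrBr.
  have q0 : q = 0.
    apply: (@roots_geq_poly_eq0 _ q [seq t k | k <- enum 'I_d.+1]).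
    - by apply/allP => _ /mapP[k _ ->].
    - by rewrite map_inj_uniq ?enum_uniq.
    - by rewrite size_map size_enum_ord size_poly.
  apply/rowP => i; rewrite mxE.
  have := coef0 R i.+1; rewrite -q0 coef_poly ltnS ltn_ord.
  have -> : inord i.+1 = lift ord0 i by apply/val_inj; rewrite /= inordK// ltnS.
  by rewrite liftK.
rewrite unitmx_tr in Du.
by rewrite /row_free mxrankMfree// mxrank_unit.
Qed.

Lemma affdim_cover (R : realType) (n N : nat) (P : set 'rV[R]_n)
    (Q : 'I_N -> set 'rV[R]_n) :
  polyhedron P -> P `<=` \bigcup_i Q i ->
  (affdim P <= \max_(i < N) affdim (Q i))%N.
Proof.
move=> polP PQ; apply/bigmax_leqP => -[d dn] /asboolP[p [/= Pp ip]].
pose K := (N * d.+1).+1.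
pose s (k : 'I_K) : R := k%:R / (K * d.+1)%:R.
have Kd0 : 0 < (K * d.+1)%:R :> R by rewrite ltr0n.
have s_inj : injective s.
  move=> k l /(congr1 ( *%R^~ (K * d.+1)%:R)); rewrite /s !divfK ?gt_eqF//.
  by move/eqP; rewrite eqr_nat => /eqP/val_inj.
have s0 k : 0 <= s k by rewrite divr_ge0.
have sd k : s k * d.+1%:R <= 1.
  rewrite /s mulrAC ler_pdivrMr// mul1r -natrM ler_nat leq_mul2r.
  by rewrite (ltnW (ltn_ord k)) orbT.
pose q k := p ord0 + \sum_(i < d) s k ^+ i.+1 *: (p (lift ord0 i) - p ord0).
have Pq k : P (q k).
  have h1 : s k * d%:R <= 1.
    by apply: le_trans (sd k); rewrite ler_wpM2l// ler_nat.
  apply: (@polyhedron_moment R n d P p (s k)) => //; apply: le_trans (sd k).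
  by rewrite -[leLHS]mulr1 ler_wpM2l// ler1n.
have /choice[c Hc] k : exists i, Q i (q k).
  by have [i _ Qi] := PQ _ (Pq k); exists i.
have [i Hi] : exists i, (d < #|[set k | c k == i]%SET|)%N.
  apply/existsP; rewrite -[X in is_true X]negbK negb_exists; apply/negP => /forallP H.
  have : (\sum_(i < N) #|[set k | c k == i]%SET| <= \sum_(i < N) d)%N.
    by apply: leq_sum => i _; rewrite leqNgt.
  rewrite sum_nat_const card_ord.
  have -> : (\sum_(i < N) #|[set k | c k == i]%SET| = K)%N.
    rewrite -[RHS]card_ord -sum1_card (partition_big c xpredT)//=.
    by apply: eq_bigr => i _; rewrite -sum1_card; apply: eq_bigl => k; rewrite !inE.
  by rewrite /K mulnS ltnNge leq_addl.
apply: leq_trans (leq_bigmax i).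
pose f (j : 'I_d.+1) : 'I_K := enum_val (widen_ord Hi j).
apply: (@affdim_le _ _ _ _ (fun j => q (f j))).
  move=> j; have := enum_valP (widen_ord Hi j); rewrite inE => /eqP <-; exact: Hc.
apply: (affine_indep_moment (t := fun j => s (f j))) => // j l /s_inj/enum_val_inj.
by move/(congr1 val) => /= /val_inj.
Qed.

Lemma polyhedral_dimE (R : realType) (n N : nat) (Q : 'I_N -> set 'rV[R]_n) :
  (forall i, polyhedron (Q i)) ->
  polyhedral_dim (\bigcup_i Q i) = \max_(i < N) affdim (Q i).
Proof.
move=> polQ; apply/eqP; rewrite eqn_leq; apply/andP; split.
  apply/bigmax_leqP => d /asboolP[P [polP PQ <-]]; exact: affdim_cover.
apply/bigmax_leqP => i _.
have dn : (affdim (Q i) < n.+1)%N by rewrite ltnS affdim_ub.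
apply: (@leq_bigmax_cond _ _ (fun i : 'I_n.+1 => nat_of_ord i) (Ordinal dn)).
by apply/asboolP; exists (Q i); split => //; exact: bigcup_sup.
Qed.

(* A fan tropical curve in PT^n: distinct rays pos(v_i) with multiplicities.
   Each v_i is the minimal nonnegative integer representative, whose class is
   then the primitive generator of the ray in Z^(n+1) / Z1; balancing at the
   origin says that the weighted sum of these generators is 0 in the quotient. *)
Record fan_curve (n : nat) := FanCurve {
  nrays : nat;
  dir : 'I_nrays -> 'rV[nat]_n.+1;
  mult : 'I_nrays -> nat;
  nrays_gt0 : (0 < nrays)%N;
  dir_inj : injective dir;
  dir_min : forall i, exists j, dir i ord0 j = 0%N;
  dir_primitive : forall i, (\big[gcdn/0]_j dir i ord0 j = 1)%N;
  mult_gt0 : forall i, (0 < mult i)%N;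
  balanced : exists d : nat, forall j, (\sum_i mult i * dir i ord0 j = d)%N }.

Definition deg (n : nat) (G : fan_curve n) : nat :=
  (\sum_i mult i * dir (f := G) i ord0 ord0)%N.

Lemma degE (n : nat) (G : fan_curve n) (j : 'I_n.+1) :
  (\sum_i mult i * dir (f := G) i ord0 j = deg G)%N.
Proof. by have [d Hd] := balanced G; rewrite /deg !Hd. Qed.

Definition curve_support (R : realType) (n : nat) (G : fan_curve n) : set 'rV[R]_n :=
  [set y | exists (i : 'I_(nrays G)) (t : R),
             0 <= t /\ y = PTcoord (t *: map_mx (fun k : nat => k%:R) (dir i))].

Arguments curve_support R {n} G.

(* Main.v *)
Require Import Defs.
From mathcomp Require Import all_boot all_order all_algebra.
From mathcomp Require Import boolp classical_sets reals.
From mathcomp Require Import lra.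

(** Every point [x] of the tropical convex hull has at most [deg G + 1] distinct
    coordinates.  Indeed [x_j] is a minimum of terms [c + t * v_i(j)] with
    [t >= 0], so if ray [i] attains it then [x_j] depends only on [i] and on
    [a = v_i(j)].  Let [x_J] be the largest coordinate.  If [x_j < x_J], then
    [c + t * a = x_j < x_J <= c + t * v_i(J)] forces [a < v_i(J)], and there are
    [\sum_i v_i(J) <= \sum_i m_i * v_i(J) = deg G] such pairs [(i, a)].  Hence the
    hull is covered by finitely many linear subspaces of dimension at most
    [deg G] of PT^n, one for each way of identifying coordinates. *)

Set Implicit Arguments.
Unset Strict Implicit.
Unset Printing Implicit Defensive.

Import Order.TTheory GRing.Theory Num.Theory.

Local Open Scope classical_set_scope.
Local Open Scope ring_scope.

Lemma tlincomb_entry (R : realType) (m k : nat) (c : 'I_k.+1 -> R)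
    (u : 'I_k.+1 -> 'rV[R]_m) (j : 'I_m) :
  tlincomb c u 0 j = \big[Num.min/c ord0 + u ord0 0 j]_(i < k)
    (c (lift ord0 i) + u (lift ord0 i) 0 j).
Proof.
rewrite /tlincomb.
by elim/big_ind2 : _ => [|x x' y y' <- <-|i _]; rewrite !mxE.
Qed.

Lemma tlincomb_le (R : realType) (m k : nat) (c : 'I_k.+1 -> R)
    (u : 'I_k.+1 -> 'rV[R]_m) (l : 'I_k.+1) (j : 'I_m) :
  tlincomb c u 0 j <= c l + u l 0 j.
Proof.
rewrite tlincomb_entry; case: (unliftP ord0 l) => [i ->|->].
  exact: (bigmin_le_cond _ (fun i => c (lift ord0 i) + u (lift ord0 i) 0 j)).
exact: bigmin_le_id.
Qed.

Lemma tlincomb_attained (R : realType) (m k : nat) (c : 'I_k.+1 -> R)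
    (u : 'I_k.+1 -> 'rV[R]_m) (j : 'I_m) :
  exists l, tlincomb c u 0 j = c l + u l 0 j.
Proof.
rewrite tlincomb_entry.
elim/big_ind : _ => [|x y [l1 ->] [l2 ->]|i _]; [by exists ord0| |by eexists].
by rewrite minEle; case: ifP => _; eexists.
Qed.

Lemma affdim_row_space_le (R : realType) (n d : nat) (W : 'M[R]_(d, n)) :
  (affdim [set z : 'rV[R]_n | (z <= W)%MS] <= d)%N.
Proof.
apply/bigmax_leqP => e /asboolP[p [pW /eqP <-]].
apply: leq_trans (rank_leq_row W); apply/mxrankS/row_subP => i.
rewrite rowK; apply: addmx_sub; first exact: pW.
by rewrite eqmx_opp; exact: pW.
Qed.

(* The rows of this matrix span, in PT^n, the points whose representatives are
   constant on the fibres of [g]; the fibre of [0] needs no row because the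
   representative with zeroth coordinate [0] vanishes on it. *)
Definition fibre_mx (R : realType) (n d : nat) (g : 'I_n.+1 -> 'I_d.+1) :
    'M[R]_(d, n) :=
  \matrix_(k, j) (lift (g ord0) k == g (lift ord0 j))%:R.

Lemma PTcoord_fibre_sub (R : realType) (n d : nat) (g : 'I_n.+1 -> 'I_d.+1)
    (x : 'rV[R]_n.+1) :
  (forall j j', g j = g j' -> x 0 j = x 0 j') ->
  (PTcoord x <= fibre_mx R g)%MS.
Proof.
move=> gx.
(* The default [0] on an empty fibre is harmless, since the matching row of [fibre_mx] is zero. *)
pose y k := if [pick j | g j == k] is Some j then x 0 j else 0.
have yE j : y (g j) = x 0 j.
  rewrite /y; case: pickP => [j' /eqP /gx //|/(_ j)]; by rewrite eqxx.
apply/submxP; exists (\row_k (y (lift (g ord0) k) - x 0 ord0)).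
apply/rowP => j; rewrite !mxE.
under eq_bigr do rewrite !mxE.
case: (unliftP (g ord0) (g (lift ord0 j))) => [k gk|gk].
  rewrite (bigD1 k) //= big1 ?addr0 -?gk ?eqxx ?mulr1 ?yE // => i /negPf ik.
  by rewrite gk (inj_eq lift_inj) ik mulr0.
rewrite (gx _ _ gk) subrr big1 // => i _.
by rewrite gk eq_sym (negPf (neq_lift _ _)) mulr0.
Qed.

(** These are the labels of coordinates: a ray [i] with an entry below [v_i(J)], or [None] for the
    largest value, whence the successor. The bound uses that each multiplicity is at least 1. *)
Lemma card_sum_dir_le_deg (n : nat) (G : fan_curve n) (J : 'I_n.+1) :
  (#|{: option {i : 'I_(nrays G) & 'I_(dir i ord0 J)}}| <= (deg G).+1)%N.
Proof.
rewrite card_option card_tagged sumnE big_map big_enum /= ltnS -(degE G J).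
apply: leq_sum => i _; rewrite card_ord; exact/leq_pmull/mult_gt0.
Qed.

Lemma tconv_curve_few_values (R : realType) (n : nat) (G : fan_curve n)
    (x : 'rV[R]_n.+1) :
  tconv (@PTcoord R n @^-1` curve_support R G) x ->
  exists g : 'I_n.+1 -> 'I_(deg G).+1,
    forall j j', g j = g j' -> x 0 j = x 0 j'.
Proof.
move=> [k [c [u [uG ->]]]]; set x' := tlincomb c u.
pose v (i : 'I_(nrays G)) j : R := (dir i ord0 j)%:R.
(* Only the class of [u l] lies on the curve, so its lift also carries a shift [b] along the
   all-ones vector. *)
have /choice[f fP] l : exists p : 'I_(nrays G) * R * R,
    0 <= p.1.2 /\ forall j, u l 0 j = p.2 + p.1.2 * v p.1.1 j.
  have [i [t [t0 /esym/PTcoord_eq[b uE]]]] := uG l.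
  by exists (i, t, b); split => // j; rewrite uE !mxE.
have [J JP] : exists J, forall j, x' 0 j <= x' 0 J.
  by case: (arg_maxP (x' 0) (erefl true : xpredT (ord0 : 'I_n.+1))) => J _ HJ;
    exists J => j; exact: HJ.
pose T := {i : 'I_(nrays G) & 'I_(dir i ord0 J)}.
(* The term attaining [x' 0 j] bounds [x'] from above at every [j'] where its ray has the same
   entry. Used in both directions at the end, this yields equality. *)
have attained j : exists i : 'I_(nrays G),
    (forall j', dir i ord0 j' = dir i ord0 j -> x' 0 j' <= x' 0 j) /\
    (x' 0 j < x' 0 J -> (dir i ord0 j < dir i ord0 J)%N).
  have [l xl] := tlincomb_attained c u j.
  have [t0 ul] := fP l; exists (f l).1.1.
  have le_l j' := tlincomb_le c u l j'; rewrite -/x' in le_l xl.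
  split=> [j' e|xJ].
    by rewrite xl; apply: le_trans (le_l j') _; rewrite !ul /v e.
  rewrite ltnNge -(ler_nat R); apply/negP => vle.
  have := ler_wpM2l t0 vle; have := le_l J.
  by move: xJ; rewrite xl !ul /v; lra.
have /choice[phi phiP] j : exists o : option T,
    if o is Some p then nat_of_ord (tagged p) = dir (tag p) ord0 j /\
      forall j', dir (tag p) ord0 j' = dir (tag p) ord0 j -> x' 0 j' <= x' 0 j
    else x' 0 j = x' 0 J.
  have [xJ|xJ] := ltP (x' 0 j) (x' 0 J).
    have [i [H1 /(_ xJ) H2]] := attained j.
    by exists (Some (Tagged (fun i => 'I_(dir i ord0 J)) (Ordinal H2))).
  by exists None; apply/eqP; rewrite eq_le JP.
exists (fun j => widen_ord (card_sum_dir_le_deg G J) (enum_rank (phi j))).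
move=> j j' /(congr1 val)/= /val_inj/enum_rank_inj e.
have := phiP j; have := phiP j'; rewrite e; case: (phi j') => [p|].
  move=> [pj' H'] [pj H]; apply/eqP; rewrite eq_le.
  by rewrite H ?H' // -pj -pj'.
by move=> -> ->.
Qed.

Theorem theorem3p4 (R : realType) (n : nat) (G : fan_curve n) :
  (polyhedral_dim (PTconv (curve_support R G)) <= deg G)%N.
Proof.
apply/bigmax_leqP => d /asboolP[P [polP PG <-]].
(* One subspace per map [g], indexed by an ordinal to fit the finite covers of [affdim_cover]. *)
pose Q (i : 'I_#|{: {ffun 'I_n.+1 -> 'I_(deg G).+1}}|) :=
  [set z : 'rV[R]_n | (z <= fibre_mx R (enum_val i : {ffun _ -> _}))%MS].
have PQ : P `<=` \bigcup_i Q i.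
  move=> _ /PG[x /tconv_curve_few_values[g gx] <-].
  exists (enum_rank (finfun g)) => //; rewrite /Q /= enum_rankK.
  by apply: PTcoord_fibre_sub => j j'; rewrite !ffunE => /gx.
apply: leq_trans (affdim_cover polP PQ) _.
by apply/bigmax_leqP => i _; exact: affdim_row_space_le.
Qed.
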